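(* Let $k$ and $n$ be positive integers. Then $$2\sum_{i=0}^k\bigl(1+n(k+1-i)\bigr)\binom{2k+2}{2i}S_{2i}(n)\equiv -2\pmod{n^3}$$ and $$2\sum_{i=0}^k\left(\binom{2k+2}{2i}+n(k+1)\binom{2k+1}{2i}\right)S_{2i}(n)\equiv -2\pmod{n^3}.$$
   Context: For integers $j\ge 0$ and $n\ge 1$, $S_j(n):=\sum_{i=1}^{n-1} i^j$ (empty sum $=0$ for $n=1$); in particular $S_0(n)=n-1$. *)

(* Defs.v *)
From mathcomp Require Import all_boot all_order all_algebra.

Set Implicit Arguments.
Unset Strict Implicit.
Unset Printing Implicit Defensive.

Definition powsum (j n : nat) : nat := (\sum_(1 <= i < n) i ^ j)%N.

(* Main.v *)
Require Import Defs.
From mathcomp Require Import all_boot all_order all_algebra.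
From mathcomp Require Import ring zify.

(** The two congruences are one statement, because
    (k+1-i) C(2k+2, 2i) = (k+1) C(2k+1, 2i): both left-hand sides are equal
    natural numbers ([half_absorption]).

    The common value is computed in closed form.  Exchanging the sum over i
    with the sum over x that defines the power sums, the inner sums are even
    parts of binomial expansions ([binomial_even_part]):
      2 sum_(i <= k) C(2k+2, 2i) x^(2i) = (x+1)^(2k+2) - 2 x^(2k+2) + (x-1)^(2k+2),
      2 sum_(i <= k) C(2k+1, 2i) x^(2i) = (x+1)^(2k+1) - (x-1)^(2k+1).
    The first is a second difference and the second a double-step first
    difference, so both telescope over 0 < x < n, to
      n^(2k+2) - 1 - (n-1)^(2k+2)   and   n^(2k+1) + (n-1)^(2k+1) - 1.
    With the weights 1 and n(k+1), the powers of n vanish modulo n^3 since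
    k > 0, and expanding (n-1)^(2k+1) to second order in n
    ([expr_odd_pred_mod_cube]) makes the terms in n and n^2 cancel, which
    leaves -2. *)

Import GRing.Theory.
Local Open Scope ring_scope.

Lemma big_nat_double (V : nmodType) (F : nat -> V) p :
  \sum_(0 <= j < (2 * p)%N) F j =
  \sum_(0 <= i < p) (F (2 * i)%N + F (2 * i).+1).
Proof.
elim: p => [|p IHp]; first by rewrite !big_geq.
have -> : (2 * p.+1 = (2 * p).+2)%N by lia.
by rewrite !big_nat_recr //= IHp addrA.
Qed.

(** The range may exceed N because the binomial coefficients vanish there;
    this lets a single range cut into pairs serve both parities of N. *)
Lemma exprD1n_widen (R : comNzRingType) (x : R) {N p : nat} :
  (N < p)%N -> (1 + x) ^+ N = \sum_(0 <= j < p) 'C(N, j)%:R * x ^+ j.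
Proof.
move=> ltNp; rewrite exprDn (big_cat_nat (n := N.+1)) //= [X in _ + X]big_nat.
rewrite [X in _ + X]big1 => [|j /andP[ltNj _]]; last by rewrite bin_small ?mul0r.
rewrite addr0 big_mkord; apply: eq_bigr => j _.
by rewrite expr1n mul1r mulr_natl.
Qed.

(** Changing the sign of x cancels the odd terms and doubles the even ones. *)
Lemma binomial_even_part (R : comNzRingType) (x : R) {N p : nat} :
  (N < 2 * p)%N ->
  2%:R * \sum_(0 <= i < p) 'C(N, 2 * i)%:R * x ^+ (2 * i) =
  (1 + x) ^+ N + (1 - x) ^+ N.
Proof.
move=> ltN2p; rewrite !(exprD1n_widen _ _ ltN2p) !big_nat_double -big_split /=.
rewrite big_distrr; apply: eq_bigr => i _ /=.
rewrite !exprS !exprM sqrrN; ring.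
Qed.

(** Both sides equal half of (2k+2-2i) C(2k+2, 2i), by absorption. *)
Lemma half_absorption k i :
  ((k + 1 - i) * 'C(2 * k + 2, 2 * i) = (k + 1) * 'C(2 * k + 1, 2 * i))%N.
Proof.
have := mul_bin_down (2 * k + 2) (2 * i).
have -> : ((2 * k + 2).-1 = 2 * k + 1)%N by lia.
have -> : (2 * k + 2 - 2 * i = 2 * (k + 1 - i))%N by lia.
have -> : (2 * k + 2 = 2 * (k + 1))%N by lia.
by rewrite -!mulnA => /eqP; rewrite eqn_pmul2l // => /eqP ->.
Qed.

Lemma sum_binomial_powsum (N k n : nat) :
  (\sum_(0 <= i < k.+1) 'C(N, 2 * i) * powsum (2 * i) n)%N%:Z =
  \sum_(1 <= x < n) \sum_(0 <= i < k.+1) 'C(N, 2 * i)%:R * x%:Z ^+ (2 * i).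
Proof.
rewrite exchange_big /= -natz natr_sum; apply: eq_bigr => i _.
rewrite natrM /powsum natr_sum big_distrr; apply: eq_bigr => x _ /=.
by rewrite natrX (natz x).
Qed.

Lemma sum_binomial_powsum_odd (k n : nat) : (0 < n)%N ->
  2 * (\sum_(0 <= i < k.+1) 'C(2 * k + 1, 2 * i) * powsum (2 * i) n)%N%:Z =
  n%:Z ^+ (2 * k + 1) + (n%:Z - 1) ^+ (2 * k + 1) - 1.
Proof.
move=> n_gt0; rewrite sum_binomial_powsum big_distrr /=.
have ltN : (2 * k + 1 < 2 * k.+1)%N by lia.
under eq_bigr => x _ do rewrite (binomial_even_part _ _ ltN).
elim: n n_gt0 => // -[|n] IHn _.
  by rewrite big_geq // subrr addn1 expr0n expr1n addr0 subrr.
rewrite big_nat_recr //= IHn //.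
have -> : 1 - n.+1%:Z = - (n.+1%:Z - 1) by ring.
have -> : n.+2%:Z = 1 + n.+1%:Z by lia.
have -> : 1 + n.+1%:Z - 1 = n.+1%:Z by ring.
rewrite [(- _) ^+ _]exprNn addn1 [(-1) ^+ _]exprS [(-1) ^+ _]exprM sqrrN !expr1n.
ring.
Qed.

Lemma sum_binomial_powsum_even (k n : nat) : (0 < n)%N ->
  2 * (\sum_(0 <= i < k.+1) 'C(2 * k + 2, 2 * i) * powsum (2 * i) n)%N%:Z =
  n%:Z ^+ (2 * k + 2) - 1 - (n%:Z - 1) ^+ (2 * k + 2).
Proof.
move=> n_gt0; rewrite sum_binomial_powsum big_distrr /=.
have ltN : (2 * k + 2 < 2 * k.+2)%N by lia.
have step (x : int) :
    2 * \sum_(0 <= i < k.+1) 'C(2 * k + 2, 2 * i)%:R * x ^+ (2 * i) =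
    (1 + x) ^+ (2 * k + 2) + (1 - x) ^+ (2 * k + 2) - 2 * x ^+ (2 * k + 2).
  rewrite -(binomial_even_part _ _ ltN) [in RHS]big_nat_recr //=.
  have -> : (2 * k.+1 = 2 * k + 2)%N by lia.
  rewrite binn; ring.
under eq_bigr => x _ do rewrite step.
elim: n n_gt0 => // -[|n] IHn _.
  by rewrite big_geq // subrr addn2 expr0n expr1n subrr.
rewrite big_nat_recr //= IHn //.
have -> : 1 - n.+1%:Z = - (n.+1%:Z - 1) by ring.
have -> : n.+2%:Z = 1 + n.+1%:Z by lia.
have -> : 1 + n.+1%:Z - 1 = n.+1%:Z by ring.
have -> : (2 * k + 2 = 2 * k.+1)%N by lia.
rewrite [(- _) ^+ _]exprNn [(-1) ^+ _]exprM sqrrN !expr1n.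
ring.
Qed.

(** The binomial expansion to second order; k (2k+1) is C(2k+1, 2). *)
Lemma expr_odd_pred_mod_cube (R : comNzRingType) (y : R) k :
  exists q : R, (y - 1) ^+ (2 * k + 1) =
    -1 + (2 * k%:R + 1) * y - k%:R * (2 * k%:R + 1) * y ^+ 2 + q * y ^+ 3.
Proof.
elim: k => [|k [q IHk]]; first by exists 0; rewrite muln0 add0n; ring.
(* Multiplying by (y - 1)^2 produces, beyond the quadratic truncation, the
   terms whose factor in front of y^3 is the witness below. *)
exists ((2 * k%:R + 1) + 2 * (k%:R * (2 * k%:R + 1))
        - k%:R * (2 * k%:R + 1) * y + q * (y - 1) ^+ 2).
have -> : (2 * k.+1 + 1 = (2 * k + 1) + 2)%N by lia.
rewrite exprD IHk -[k.+1%:R]natr1; ring.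
Qed.

Lemma weighted_sum_mod_cube (k n : nat) : (0 < k)%N -> (0 < n)%N ->
  (Posz (2 * \sum_(0 <= i < k.+1)
           ('C(2 * k + 2, 2 * i) + n * (k + 1) * 'C(2 * k + 1, 2 * i))
             * powsum (2 * i) n)%N
     = -2 %[mod Posz (n ^ 3)%N])%Z.
Proof.
move=> k_gt0 n_gt0.
under eq_bigr => i _ do rewrite mulnDl -mulnA.
rewrite big_split -big_distrr /=.
have even_sum := sum_binomial_powsum_even k n n_gt0.
have odd_sum := sum_binomial_powsum_odd k n n_gt0.
set A := (\sum_(0 <= i < k.+1) _)%N in even_sum *.
set B := (\sum_(0 <= i < k.+1) _)%N in odd_sum *.
have -> : (2 * (A + n * (k + 1) * B))%N%:Z
          = 2 * A%:Z + n%:Z * (k%:Z + 1) * (2 * B%:Z).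
  by rewrite !(PoszM, PoszD); ring.
rewrite even_sum odd_sum.
have [q expand] := expr_odd_pred_mod_cube int n%:Z k.
have -> : (2 * k + 2 = (2 * k + 1).+1)%N by lia.
rewrite 2!exprS expand natz.
case: k k_gt0 {even_sum odd_sum A B expand} => // k _.
have -> : (2 * k.+1 + 1 = 2 * k + 3)%N by lia.
have -> : (n ^ 3)%N%:Z = n%:Z ^+ 3 by rewrite -natz natrX (natz n).
apply/eqP; rewrite eqz_mod_dvd; apply/dvdzP.
(* Quotient by n^3: the pure powers of n, the remainders q of the expansion,
   and the cubic terms of its product with n - 1. *)
exists (n%:Z ^+ (2 * k) * (n%:Z + n%:Z * (k.+1%:Z + 1))
        - q * (n%:Z - 1) + k.+1%:Z * (2 * k.+1%:Z + 1)
        + n%:Z * (k.+1%:Z + 1) * q - (k.+1%:Z + 1) * (k.+1%:Z * (2 * k.+1%:Z + 1))).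
rewrite exprD; ring.
Qed.

Theorem proposition2p15 (k n : nat) (hk : (0 < k)%N) (hn : (0 < n)%N) :
  (Posz (2 * \sum_(0 <= i < k.+1)
           (1 + n * (k + 1 - i)) * 'C(2 * k + 2, 2 * i) * powsum (2 * i) n)%N
     = -2 %[mod Posz (n ^ 3)%N])%Z
  /\
  (Posz (2 * \sum_(0 <= i < k.+1)
           ('C(2 * k + 2, 2 * i) + n * (k + 1) * 'C(2 * k + 1, 2 * i))
             * powsum (2 * i) n)%N
     = -2 %[mod Posz (n ^ 3)%N])%Z.
Proof.
split; last exact: weighted_sum_mod_cube.
under eq_bigr => i _ do rewrite mulnDl mul1n -mulnA half_absorption mulnA.
exact: weighted_sum_mod_cube.
Qed.
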